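(* Consider the step-by-step construction of $18$ lines in the projective plane, depending on two parameters $a,b$ with $a\neq 1$, $b\neq 1$, $a\neq b$, described in the context. In it some of the $46$ points are not necessarily triple; the conditions to have them triple are $$\begin{aligned}P_{29}&=P_6P_8\cap P_{17}P_{21}\cap P_{19}P_{20}, & P_{37}&=P_1P_9\cap P_{11}P_{27}\cap P_{19}P_{20},\\ P_{30}&=P_7P_8\cap P_{18}P_{22}\cap P_{19}P_{20}, & P_{38}&=P_1P_{10}\cap P_{12}P_{28}\cap P_{19}P_{20},\\ P_{31}&=P_2P_{24}\cap P_3P_4\cap P_{17}P_{21}, & P_{39}&=P_2P_{24}\cap P_3P_5\cap P_{19}P_{20},\\ P_{32}&=P_2P_4\cap P_3P_{25}\cap P_{18}P_{22}, & P_{40}&=P_2P_5\cap P_3P_{25}\cap P_{19}P_{20},\\ P_{35}&=P_{17}P_{21}\cap P_{12}P_{28}\cap P_{14}P_{16}, & P_{44}&=P_2P_{24}\cap P_6P_8\cap P_{12}P_{28},\\ P_{36}&=P_{11}P_{27}\cap P_{13}P_{15}\cap P_{18}P_{22}, & P_{45}&=P_3P_{25}\cap P_7P_8\cap P_{11}P_{27}.\end{aligned}$$ These imply several algebraic conditions on $a$ and $b$, but only one of them does not lead to a degenerate case. This condition provides the parametrization curve of the $\mathbb{B}_{18}$ configurations, $C_{18}(a,b)=0$, where $$\begin{aligned}C_{18}(a,b)=\;& a^3b^5-a^5b^2+a^4b^3-6a^3b^4+a^2b^5+a^6+a^4b^2+12a^3b^3-4a^2b^4-5a^5+7a^4b\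\&-22a^3b^2+11a^2b^3-ab^4+6a^4-a^3b+3a^2b^2-4ab^3+b^4-4a^3+4a^2b-ab^2.\end{aligned}$$
   Context: Original Böröczky configuration of $n$ lines: fix a point $Q_0$ on a circle and let $Q_\alpha$ be its rotation by the angle $\alpha$ about the center; the lines are $Q_\alpha Q_{\pi-2\alpha}$, $\alpha=2k\pi/n$, $k=0,\dots,n-1$ (the tangent at $Q_\alpha$ if $\alpha\equiv\pi-2\alpha$ mod $2\pi$). It has $\lfloor n(n-3)/6\rfloor+1$ triple points (points where three of the lines meet), i.e. $46$ for $n=18$. A configuration $\mathbb{B}_n$ is a modification of it: $n$ lines in the projective plane with the same incidences; it is degenerate if some of its points or lines coincide. The parametrization curve of the $\mathbb{B}_n$ is the curve of parameter values $(a,b)$ satisfying the condition for the construction to produce all the required triple points (factors leading to degenerate cases being discarded); individual points of this curve may still give degenerate configurations. Construction of $\mathbb{B}_{18}$ ($XY$ denotes the line through $X$ and $Y$). Points $P_1=(1:0:0)$, $P_2=(0:1:0)$, $P_3=(0:0:1)$, $P_4=(1:1:1)$. Lines $P_1P_4,\ P_2P_4,\ P_3P_4$. Parameter point $P_5=(a:1:1)\in P_1P_4$. Lines $P_2P_5,\ P_3P_5$. Points $P_6=P_2P_4\cap P_3P_5$, $P_7=P_3P_4\cap P_2P_5$. Parameter point $P_8=(b:1:1)\in P_1P_4$. Lines $P_6P_8,\ P_7P_8$. Points $P_9=P_2P_5\cap P_6P_8$, $P_{10}=P_3P_5\cap P_7P_8$, $P_{11}=P_3P_4\cap P_6P_8$,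 $P_{12}=P_2P_4\cap P_7P_8$. Lines $P_1P_9,\ P_1P_{10}$. Points $P_{13}=P_3P_4\cap P_1P_9$, $P_{14}=P_2P_4\cap P_1P_{10}$, $P_{15}=P_1P_{10}\cap P_6P_8$, $P_{16}=P_1P_9\cap P_7P_8$, $P_{17}=P_2P_4\cap P_1P_9$, $P_{18}=P_3P_4\cap P_1P_{10}$. Lines $P_{13}P_{15},\ P_{14}P_{16}$. Points $P_{19}=P_2P_4\cap P_{13}P_{15}$, $P_{20}=P_3P_4\cap P_{14}P_{16}$, $P_{21}=P_2P_5\cap P_{13}P_{15}$, $P_{22}=P_3P_5\cap P_{14}P_{16}$, $P_{23}=P_1P_4\cap P_{13}P_{15}$, $P_{24}=P_7P_{10}\cap P_{13}P_{15}$, $P_{25}=P_6P_9\cap P_{14}P_{16}$. Lines $P_{17}P_{21},\ P_{18}P_{22},\ P_{19}P_{20}$. Points $P_{26}=P_{17}P_{21}\cap P_1P_4$, $P_{27}=P_3P_5\cap P_{17}P_{21}$, $P_{28}=P_{18}P_{22}\cap P_2P_5$, $P_{29}=P_{19}P_{20}\cap P_{17}P_{21}$, $P_{30}=P_{19}P_{20}\cap P_{18}P_{22}$, $P_{31}=P_3P_4\cap P_{17}P_{21}$, $P_{32}=P_2P_4\cap P_{18}P_{22}$, $P_{33}=P_1P_{10}\cap P_{17}P_{21}$, $P_{34}=P_1P_9\cap P_{18}P_{22}$, $P_{35}=P_{17}P_{21}\cap P_{14}P_{16}$, $P_{36}=P_{18}P_{22}\cap P_{13}P_{15}$, $P_{37}=P_{19}P_{20}\cap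 P_1P_9$, $P_{38}=P_{19}P_{20}\cap P_1P_{10}$, $P_{39}=P_3P_5\cap P_{19}P_{20}$, $P_{40}=P_2P_5\cap P_{19}P_{20}$. Lines $P_2P_{24},\ P_3P_{25},\ P_{11}P_{27},\ P_{12}P_{28}$. Points $P_{41}=P_2P_{24}\cap P_1P_{10}$, $P_{42}=P_3P_{25}\cap P_1P_9$, $P_{43}=P_1P_4\cap P_{11}P_{27}$, $P_{44}=P_2P_{24}\cap P_6P_8$, $P_{45}=P_3P_{25}\cap P_7P_8$, $P_{46}=P_1P_4\cap P_2P_{24}$. *)

(* Defs.v *)
From HB Require Import structures.
From mathcomp Require Import all_boot all_order all_algebra.

Set Implicit Arguments.
Unset Strict Implicit.
Unset Printing Implicit Defensive.

Import GRing.Theory.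
Local Open Scope ring_scope.

(* The projective plane over F is modelled by the subspaces of F^3: points are
   the subspaces of dimension 1 and lines those of dimension 2, so that the
   line through X and Y is X + Y and the intersection of lines is :&:. *)

(* The point (x : y : z); meaningful only when x, y, z are not all zero. *)
Definition pt (F : fieldType) (x y z : F) : {vspace 'rV[F]_3} :=
  <[\row_i [:: x; y; z]`_i]>%VS.

(* Q lies on at least three distinct members of ls. *)
Definition triple_point (F : fieldType) (ls : seq {vspace 'rV[F]_3})
    (Q : {vspace 'rV[F]_3}) : bool :=
  (3 <= count (fun l => (Q <= l)%VS) (undup ls))%N.

Section B18.

Context (F : fieldType) (a b : F).

Definition P1 := @pt F 1 0 0.
Definition P2 := @pt F 0 1 0.
Definition P3 := @pt F 0 0 1.
Definition P4 := @pt F 1 1 1.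

Definition P1P4 := (P1 + P4)%VS.
Definition P2P4 := (P2 + P4)%VS.
Definition P3P4 := (P3 + P4)%VS.

Definition P5 := pt a 1 1.

Definition P2P5 := (P2 + P5)%VS.
Definition P3P5 := (P3 + P5)%VS.

Definition P6 := (P2P4 :&: P3P5)%VS.
Definition P7 := (P3P4 :&: P2P5)%VS.

Definition P8 := pt b 1 1.

Definition P6P8 := (P6 + P8)%VS.
Definition P7P8 := (P7 + P8)%VS.

Definition P9 := (P2P5 :&: P6P8)%VS.
Definition P10 := (P3P5 :&: P7P8)%VS.
Definition P11 := (P3P4 :&: P6P8)%VS.
Definition P12 := (P2P4 :&: P7P8)%VS.

Definition P1P9 := (P1 + P9)%VS.
Definition P1P10 := (P1 + P10)%VS.

Definition P13 := (P3P4 :&: P1P9)%VS.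
Definition P14 := (P2P4 :&: P1P10)%VS.
Definition P15 := (P1P10 :&: P6P8)%VS.
Definition P16 := (P1P9 :&: P7P8)%VS.
Definition P17 := (P2P4 :&: P1P9)%VS.
Definition P18 := (P3P4 :&: P1P10)%VS.

Definition P13P15 := (P13 + P15)%VS.
Definition P14P16 := (P14 + P16)%VS.

Definition P19 := (P2P4 :&: P13P15)%VS.
Definition P20 := (P3P4 :&: P14P16)%VS.
Definition P21 := (P2P5 :&: P13P15)%VS.
Definition P22 := (P3P5 :&: P14P16)%VS.
Definition P23 := (P1P4 :&: P13P15)%VS.

Definition P7P10 := (P7 + P10)%VS.

Definition P24 := (P7P10 :&: P13P15)%VS.

Definition P6P9 := (P6 + P9)%VS.

Definition P25 := (P6P9 :&: P14P16)%VS.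

Definition P17P21 := (P17 + P21)%VS.
Definition P18P22 := (P18 + P22)%VS.
Definition P19P20 := (P19 + P20)%VS.

Definition P26 := (P17P21 :&: P1P4)%VS.
Definition P27 := (P3P5 :&: P17P21)%VS.
Definition P28 := (P18P22 :&: P2P5)%VS.
Definition P29 := (P19P20 :&: P17P21)%VS.
Definition P30 := (P19P20 :&: P18P22)%VS.
Definition P31 := (P3P4 :&: P17P21)%VS.
Definition P32 := (P2P4 :&: P18P22)%VS.
Definition P33 := (P1P10 :&: P17P21)%VS.
Definition P34 := (P1P9 :&: P18P22)%VS.
Definition P35 := (P17P21 :&: P14P16)%VS.
Definition P36 := (P18P22 :&: P13P15)%VS.
Definition P37 := (P19P20 :&: P1P9)%VS.
Definition P38 := (P19P20 :&: P1P10)%VS.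
Definition P39 := (P3P5 :&: P19P20)%VS.
Definition P40 := (P2P5 :&: P19P20)%VS.

Definition P2P24 := (P2 + P24)%VS.
Definition P3P25 := (P3 + P25)%VS.
Definition P11P27 := (P11 + P27)%VS.
Definition P12P28 := (P12 + P28)%VS.

Definition P41 := (P2P24 :&: P1P10)%VS.
Definition P42 := (P3P25 :&: P1P9)%VS.
Definition P43 := (P1P4 :&: P11P27)%VS.
Definition P44 := (P2P24 :&: P6P8)%VS.
Definition P45 := (P3P25 :&: P7P8)%VS.
Definition P46 := (P1P4 :&: P2P24)%VS.

(* P7P10 and P6P9 are not listed: they are further names of P7P8 and P6P8. *)
Definition B18_lines : seq {vspace 'rV[F]_3} :=
  [:: P1P4; P2P4; P3P4; P2P5; P3P5; P6P8; P7P8; P1P9; P1P10; P13P15;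
      P14P16; P17P21; P18P22; P19P20; P2P24; P3P25; P11P27; P12P28].

Definition B18_points : seq {vspace 'rV[F]_3} :=
  [:: P1; P2; P3; P4; P5; P6; P7; P8; P9; P10; P11; P12; P13; P14; P15;
      P16; P17; P18; P19; P20; P21; P22; P23; P24; P25; P26; P27; P28;
      P29; P30; P31; P32; P33; P34; P35; P36; P37; P38; P39; P40; P41;
      P42; P43; P44; P45; P46].

(* The points for which the construction itself provides only two lines. *)
Definition B18_doubtful_points : seq {vspace 'rV[F]_3} :=
  [:: P29; P30; P31; P32; P35; P36; P37; P38; P39; P40; P44; P45].

Definition B18_automatic_points : seq {vspace 'rV[F]_3} :=
  [:: P1; P2; P3; P4; P5; P6; P7; P8; P9; P10; P11; P12; P13; P14; P15;
      P16; P17; P18; P19; P20; P21; P22; P23; P24; P25; P26; P27; P28;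
      P33; P34; P41; P42; P43; P46].

Definition B18_conditions : Prop :=
  P29 = (P6P8 :&: P17P21 :&: P19P20)%VS /\
  P30 = (P7P8 :&: P18P22 :&: P19P20)%VS /\
  P31 = (P2P24 :&: P3P4 :&: P17P21)%VS /\
  P32 = (P2P4 :&: P3P25 :&: P18P22)%VS /\
  P35 = (P17P21 :&: P12P28 :&: P14P16)%VS /\
  P36 = (P11P27 :&: P13P15 :&: P18P22)%VS /\
  P37 = (P1P9 :&: P11P27 :&: P19P20)%VS /\
  P38 = (P1P10 :&: P12P28 :&: P19P20)%VS /\
  P39 = (P2P24 :&: P3P5 :&: P19P20)%VS /\
  P40 = (P2P5 :&: P3P25 :&: P19P20)%VS /\
  P44 = (P2P24 :&: P6P8 :&: P12P28)%VS /\
  P45 = (P3P25 :&: P7P8 :&: P11P27)%VS.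

(* If all points are distinct and all lines are distinct, then each join and
   each intersection of the construction has dimension 2 resp. 1; hence a
   construction in which some step is not well defined is degenerate. *)
Definition B18_degenerate : bool := ~~ (uniq B18_points && uniq B18_lines).

Definition C18 : F :=
  a ^+ 3 * b ^+ 5 - a ^+ 5 * b ^+ 2 + a ^+ 4 * b ^+ 3 - 6 * a ^+ 3 * b ^+ 4
  + a ^+ 2 * b ^+ 5 + a ^+ 6 + a ^+ 4 * b ^+ 2 + 12 * a ^+ 3 * b ^+ 3
  - 4 * a ^+ 2 * b ^+ 4 - 5 * a ^+ 5 + 7 * a ^+ 4 * b
  - 22 * a ^+ 3 * b ^+ 2 + 11 * a ^+ 2 * b ^+ 3 - a * b ^+ 4 + 6 * a ^+ 4
  - a ^+ 3 * b + 3 * a ^+ 2 * b ^+ 2 - 4 * a * b ^+ 3 + b ^+ 4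
  - 4 * a ^+ 3 + 4 * a ^+ 2 * b - a * b ^+ 2.

End B18.

(* Main.v *)
(* In a nondegenerate construction every point and line is given by an explicit
   vector of polynomials in a and b over the integers: cross products of earlier
   vectors, divided exactly by common factors that cannot vanish. Incidence is
   then the vanishing of a dot product. It is a polynomial identity for the
   automatic points. For the doubtful points the dot product with the missing
   third line is a multiple of C18, with a cofactor that cannot vanish in the
   case of P37, and no other line can pass through P37.

   A degenerate configuration has two proportional vectors, so that one of
   finitely many mixed products vanishes. The resultant of each of them with C18
   is not the zero polynomial: modulo 367 and at a = 217, C18 has five simple
   roots b, and no mixed product vanishes there. Hence only finitely many points
   of the curve are degenerate, whereas by the intermediate value theorem it has
   a real point for every a >= 4. *)

Require Import Defs.
From Stdlib Require Import ZArith Classical.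
From HB Require Import structures.
From mathcomp Require Import all_boot all_order all_algebra.
From mathcomp Require Import ssrZ zify ring lra.

Set Implicit Arguments.
Unset Strict Implicit.
Unset Printing Implicit Defensive.

Import GRing.Theory.
Local Open Scope ring_scope.

(** * Polynomials as coefficient lists, by increasing degree *)

Section ListPolynomial.

Context (T : Type) (zero : T) (isz : T -> bool).
Context (add : T -> T -> T) (opp : T -> T) (mul div : T -> T -> T).

Fixpoint lpadd (p q : seq T) : seq T :=
  match p, q with
  | [::], _ => q
  | _, [::] => p
  | c :: p', d :: q' => add c d :: lpadd p' q'
  end.

Definition lpmul (p q : seq T) : seq T :=
  foldr (fun c r => lpadd (map (mul c) q) (zero :: r)) [::] p.

Definition lpsub (p q : seq T) : seq T := lpadd p (map opp q).

Fixpoint lpdiv_rec n (p : seq T) (d : T) (q : seq T) : seq T :=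
  if n is n'.+1 then
    if p is c :: p' then
      let t := div c d in t :: lpdiv_rec n' (lpsub p' (map (mul t) q)) d q
    else [::]
  else [::].

(* Division by increasing powers. It is only meant for exact divisions, and
   every use of its result is justified by multiplying back. *)
Fixpoint lpdiv (p q : seq T) : seq T :=
  if q is d :: q' then
    if isz d then lpdiv (behead p) q'
    else lpdiv_rec (size p - size q') p d q'
  else [::].

(** Without trailing zeros, equal polynomials have equal lists. [step_check] relies on this when it
    compares the vectors of a line and of its alias by [==]. *)
Definition lptrim (p : seq T) : seq T :=
  foldr (fun c r => if nilp r && isz c then [::] else c :: r) [::] p.

Context (R : comNzRingType) (phi : T -> R) (x : R).

Definition lpeval (p : seq T) : R := foldr (fun c r => r * x + phi c) 0 p.

Hypothesis phi0 : phi zero = 0.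
Hypothesis phiz : forall c, isz c -> phi c = 0.
Hypothesis phiD : forall c d, phi (add c d) = phi c + phi d.
Hypothesis phiN : forall c, phi (opp c) = - phi c.
Hypothesis phiM : forall c d, phi (mul c d) = phi c * phi d.

Lemma lpevalD p q : lpeval (lpadd p q) = lpeval p + lpeval q.
Proof.
elim: p q => [|c p IH] [|d q] /=; rewrite ?add0r ?addr0 //.
by rewrite IH phiD; ring.
Qed.

Lemma lpevalN p : lpeval (map opp p) = - lpeval p.
Proof. by elim: p => [|c p IH] /=; rewrite ?oppr0 // IH phiN; ring. Qed.

Lemma lpevalZ c p : lpeval (map (mul c) p) = phi c * lpeval p.
Proof. by elim: p => [|d p IH] /=; rewrite ?mulr0 // IH phiM; ring. Qed.

Lemma lpevalM p q : lpeval (lpmul p q) = lpeval p * lpeval q.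
Proof.
elim: p => [|c p IH] /=; first by rewrite mul0r.
by rewrite lpevalD lpevalZ /= IH phi0; ring.
Qed.

Lemma lpeval_isz p : all isz p -> lpeval p = 0.
Proof.
by elim: p => //= c p IH /andP[/phiz -> /IH ->]; rewrite mul0r addr0.
Qed.

End ListPolynomial.

(** * Computable integer polynomials in one and two variables *)

Definition upoly := seq Z.

Definition uadd : upoly -> upoly -> upoly := lpadd Z.add.
Definition uopp : upoly -> upoly := map Z.opp.
Definition umul : upoly -> upoly -> upoly := lpmul Z0 Z.add Z.mul.
Definition udiv : upoly -> upoly -> upoly :=
  lpdiv (Z.eqb 0) Z.add Z.opp Z.mul Z.div.
Definition uisz : upoly -> bool := all (Z.eqb 0).

(* Polynomials in a and b, as polynomials in b over the polynomials in a. *)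
Definition bpoly := seq upoly.

Definition badd : bpoly -> bpoly -> bpoly := lpadd uadd.
Definition bopp : bpoly -> bpoly := map uopp.
Definition bsub (p q : bpoly) : bpoly := badd p (bopp q).
Definition bmul : bpoly -> bpoly -> bpoly := lpmul [::] uadd umul.
Definition bdiv (p q : bpoly) : bpoly :=
  lptrim uisz (map (lptrim (Z.eqb 0)) (lpdiv uisz uadd uopp umul udiv p q)).
Definition bisz : bpoly -> bool := all uisz.

Definition of_Z (R : nzRingType) (c : Z) : R := (int_of_Z c)%:~R.

HB.instance Definition _ (R : nzRingType) :=
  GRing.RMorphism.copy (@of_Z R) (intr \o int_of_Z).

Section Evaluation.

Context (R : comNzRingType) (phi : {rmorphism Z -> R}) (a b : R).

Definition ueval : upoly -> R := lpeval phi a.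
Definition beval : bpoly -> R := lpeval ueval b.

Lemma phi_isz c : Z.eqb 0 c -> phi c = 0.
Proof. by move/Z.eqb_eq=> <-; rewrite rmorph0. Qed.

Lemma uevalD p q : ueval (uadd p q) = ueval p + ueval q.
Proof. by apply: lpevalD => c d; rewrite -rmorphD. Qed.

Lemma uevalN p : ueval (uopp p) = - ueval p.
Proof. by apply: lpevalN => c; rewrite -rmorphN. Qed.

Lemma uevalM p q : ueval (umul p q) = ueval p * ueval q.
Proof.
by apply: lpevalM => [|c d|c d]; rewrite ?rmorph0 -?rmorphD -?rmorphM.
Qed.

Lemma ueval_isz p : uisz p -> ueval p = 0.
Proof. by apply: lpeval_isz; apply: phi_isz. Qed.

Lemma bevalD p q : beval (badd p q) = beval p + beval q.
Proof. exact: lpevalD uevalD _ _. Qed.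

Lemma bevalN p : beval (bopp p) = - beval p.
Proof. exact: lpevalN uevalN _. Qed.

Lemma bevalB p q : beval (bsub p q) = beval p - beval q.
Proof. by rewrite bevalD bevalN. Qed.

Lemma bevalM p q : beval (bmul p q) = beval p * beval q.
Proof. exact: (lpevalM _ _ uevalD uevalM). Qed.

Lemma beval_isz p : bisz p -> beval p = 0.
Proof. by apply: lpeval_isz; apply: ueval_isz. Qed.

End Evaluation.

(** Evaluation is natural in the ring. One table of coordinates thus serves over [Z], over every
    field and over polynomial rings, and facts computed in [Z] can be transported. *)
Lemma rmorph_beval (R S : comNzRingType) (phi : {rmorphism Z -> R})
    (psi : {rmorphism Z -> S}) (h : {rmorphism R -> S}) (a b : R) p :
  h \o phi =1 psi ->
  h (beval phi a b p) = beval psi (h a) (h b) p.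
Proof.
move=> hphi; elim: p => [|c p IH] /=; first exact: rmorph0.
rewrite rmorphD rmorphM IH; congr (_ + _).
elim: c => [|z c IHc] /=; first exact: rmorph0.
by rewrite rmorphD rmorphM IHc -hphi.
Qed.

(** * Cross and dot products *)

Definition cross_with T (sub mul : T -> T -> T) (u v : T * T * T) : T * T * T :=
  let: (x, y, z) := u in
  let: (x', y', z') := v in
  (sub (mul y z') (mul z y'), sub (mul z x') (mul x z'),
   sub (mul x y') (mul y x')).

Definition dot_with T (add mul : T -> T -> T) (u v : T * T * T) : T :=
  let: (x, y, z) := u in
  let: (x', y', z') := v in
  add (add (mul x x') (mul y y')) (mul z z').

Section CrossProduct.

Context (R : comNzRingType).
Implicit Types u v w : R * R * R.

Definition cross u v := cross_with (fun x y : R => x - y) *%R u v.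
Definition dot u v := dot_with +%R *%R u v.
Definition scale (c : R) u : R * R * R := (c * u.1.1, c * u.1.2, c * u.2).

Lemma cross_scale c v w : cross v (scale c w) = scale c (cross v w).
Proof.
by case: v w => [[? ?] ?] [[? ?] ?]; rewrite /cross /scale /=;
   congr (_, _, _); ring.
Qed.

Lemma dot_scale c v w : dot v (scale c w) = c * dot v w.
Proof. by case: v w => [[? ?] ?] [[? ?] ?]; rewrite /dot /scale /=; ring. Qed.

Lemma crossC u v : cross u v = scale (-1) (cross v u).
Proof.
by case: u v => [[? ?] ?] [[? ?] ?]; rewrite /cross /scale /=;
   congr (_, _, _); ring.
Qed.

Lemma dot_crossl u v : dot u (cross u v) = 0.
Proof. by case: u v => [[? ?] ?] [[? ?] ?]; rewrite /dot /cross /=; ring. Qed.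

Lemma dot_crossr u v : dot v (cross u v) = 0.
Proof. by case: u v => [[? ?] ?] [[? ?] ?]; rewrite /dot /cross /=; ring. Qed.

Lemma dotC u v : dot u v = dot v u.
Proof. by case: u v => [[? ?] ?] [[? ?] ?]; rewrite /dot /=; ring. Qed.

Lemma cross_cross u v w :
  cross u (cross v w) =
  (dot u w * v.1.1 - dot u v * w.1.1, dot u w * v.1.2 - dot u v * w.1.2,
   dot u w * v.2 - dot u v * w.2).
Proof.
by case: u v w => [[? ?] ?] [[? ?] ?] [[? ?] ?]; rewrite /cross /dot /=;
   congr (_, _, _); ring.
Qed.

End CrossProduct.

(** * Homogeneous coordinates for points and lines *)

Section Projective.

Context (F : fieldType).
Implicit Types (u v w : F * F * F) (x : 'rV[F]_3).

Local Notation zero3 := ((0, 0, 0) : F * F * F).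

Definition rowv u : 'rV[F]_3 := \row_i [:: u.1.1; u.1.2; u.2]`_i.

Definition coords3 x : F * F * F :=
  (x 0 0, x 0 (inord 1), x 0 (inord 2)).

Lemma rowvK : cancel rowv coords3.
Proof.
by case=> [[p q] r]; rewrite /coords3 /rowv !mxE /= !inordK.
Qed.

Lemma coords3K : cancel coords3 rowv.
Proof.
move=> x; apply/rowP => i; rewrite mxE /=.
by case: i => [[|[|[|//]]] h] /=; congr (x 0 _); apply: val_inj;
   rewrite /= ?inordK.
Qed.

Lemma rowv_scale c u : rowv (scale c u) = c *: rowv u.
Proof.
by apply/rowP => i; rewrite !mxE; case: i => [[|[|[|//]]] h].
Qed.

Lemma rowv_eq0 u : (rowv u == 0) = (u == zero3).
Proof.
have E : rowv zero3 = 0.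
  by apply/rowP => i; rewrite !mxE; case: i => [[|[|[|//]]] h].
by rewrite -E (inj_eq (can_inj rowvK)).
Qed.

Lemma scale_eq0 c u : (scale c u == zero3) = (c == 0) || (u == zero3).
Proof. by rewrite -!rowv_eq0 rowv_scale scaler_eq0. Qed.

Lemma cross_eq0P u v :
  u != zero3 -> reflect (exists c, v = scale c u) (cross u v == zero3).
Proof.
move=> u0; apply: (iffP eqP) => [|[c ->]]; last first.
  rewrite cross_scale; case: u {u0} => [[p q] r].
  by rewrite /cross /scale /=; congr (_, _, _); ring.
have quot (p p' q q' : F) : p != 0 -> p * q' = q * p' -> q' = p' / p * q.
  by move=> p0 e; apply: (mulfI p0); rewrite e; field.
case: u v u0 => [[p q] r] [[p' q'] r']; rewrite /cross /scale /=.
move=> u0 [/subr0_eq e1 /subr0_eq e2 /subr0_eq e3]; move: u0.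
rewrite !xpair_eqE /=.
(* The first nonzero coordinate of [u] determines the ratio. *)
case: (eqVneq p 0) => [p0|p0 _]; last first.
  exists (p' / p); congr (_, _, _); apply: quot => //; exact: mulrC.
case: (eqVneq q 0) => [q0|q0 _]; last first.
  exists (q' / q); congr (_, _, _); apply: quot => //; exact: mulrC.
case: (eqVneq r 0) => [r0|r0 _] //.
exists (r' / r); congr (_, _, _); apply: quot => //; exact: mulrC.
Qed.

Definition point u : {vspace 'rV[F]_3} := <[rowv u]>%VS.

(** The solutions of the equation with coefficient vector [w], as the kernel of a linear form so
    that rank-nullity bounds the dimension. *)
Definition line w : {vspace 'rV[F]_3} :=
  lker (linfun (mulmxr (rowv w)^T : 'rV[F]_3 -> 'rV[F]_1)).

Lemma mem_line u w : (rowv u \in line w) = (dot u w == 0).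
Proof.
have E : (rowv u *m (rowv w)^T) 0 0 = dot u w.
  rewrite mxE !big_ord_recl big_ord0 !mxE /=.
  by case: u w => [[p q] r] [[p' q'] r']; rewrite /dot /=; ring.
rewrite memv_ker lfunE /= -E; apply/eqP/eqP => [->|e]; first by rewrite mxE.
by apply/matrixP => i j; rewrite !ord1 e mxE.
Qed.

Lemma point_line u w : (point u <= line w)%VS = (dot u w == 0).
Proof. by rewrite -mem_line memvE. Qed.

Lemma neq0_dot w : w != zero3 -> exists e, dot w e != 0.
Proof.
case: w => [[p q] r]; rewrite !xpair_eqE /= !negb_and -orbA.
by case/or3P=> nz; [exists (1, 0, 0) | exists (0, 1, 0) | exists (0, 0, 1)];
   rewrite /dot /= !(mulr0, mulr1) ?addr0 ?add0r.
Qed.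

(** Cramer's rule: mixed products are 3 by 3 determinants, and the right-hand side expands [t] along
    [u], [v], [e]. *)
Lemma cramer u v t e i :
  dot (cross u v) e * rowv t 0 i =
  dot (cross t v) e * rowv u 0 i + dot (cross u t) e * rowv v 0 i
  + dot t (cross u v) * rowv e 0 i.
Proof.
rewrite !mxE; case: u v e t => [[? ?] ?] [[? ?] ?] [[? ?] ?] [[? ?] ?].
by rewrite /cross /dot /=; case: i => [[|[|[|//]]] ?] /=; ring.
Qed.

Lemma point_join u v :
  cross u v != zero3 -> (point u + point v)%VS = line (cross u v).
Proof.
move=> /neq0_dot[e De]; apply: subv_anti; rewrite subv_add !point_line.
rewrite dot_crossl dot_crossr !eqxx /=; apply/subvP => x.
rewrite -[x]coords3K mem_line => /eqP; set t := coords3 x => tD.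
pose d := dot (cross u v) e.
(* Since [t] lies on the line, its component along [e] in Cramer's rule vanishes. *)
have -> : rowv t = rowv (scale (dot (cross t v) e / d) u)
                   + rowv (scale (dot (cross u t) e / d) v).
  apply/rowP => i; apply: (mulfI De); rewrite cramer tD mul0r addr0 -/d !rowv_scale.
  rewrite [X in _ = _ * X]mxE [X in _ = _ * (X + _)]mxE.
  rewrite [X in _ = _ * (_ + X)]mxE.
  by field.
by rewrite memv_add // rowv_scale memvZ // memv_line.
Qed.

Lemma line_meet u v :
  cross u v != zero3 -> (line u :&: line v)%VS = point (cross u v).
Proof.
move=> nz; apply: subv_anti; apply/andP; split; last first.
  by rewrite subv_cap !point_line !(dotC (cross u v)) dot_crossl dot_crossr !eqxx.
apply/subvP => x; rewrite memv_cap -[x]coords3K !mem_line.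
case/andP => /eqP tu /eqP tv; rewrite /point; apply/vlineP.
(* By the triple product expansion, a vector orthogonal to [u] and [v] is parallel to their cross
   product. *)
have : cross (cross u v) (coords3 x) == zero3.
  by rewrite crossC cross_cross tu tv !mul0r !subr0 /scale /= !mulr0.
by case/(cross_eq0P _ nz) => c ->; exists c; rewrite rowv_scale.
Qed.

Lemma point_scale c u : c != 0 -> point (scale c u) = point u.
Proof.
move=> c0; apply: subv_anti; rewrite /point -!memvE rowv_scale memvZ ?memv_line //=.
by rewrite -{1}[rowv u](scalerK c0) memvZ ?memv_line.
Qed.

Lemma line_scale c w : c != 0 -> line (scale c w) = line w.
Proof.
move=> c0; apply/vspaceP => x; rewrite -[x]coords3K !mem_line dot_scale.
by rewrite mulf_eq0 (negPf c0).
Qed.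

Lemma dim_line w : (2 <= \dim (line w))%N.
Proof.
have := limg_ker_dim (linfun (mulmxr (rowv w)^T : 'rV[F]_3 -> 'rV[F]_1)) fullv.
rewrite capfv dimvf /dim /= => e; rewrite -(leq_add2r 1) /line.
rewrite (_ : 2 + 1 = 1 * 3)%N // -e leq_add2l.
by apply: leq_trans (dimvS (subvf _)) _; rewrite dimvf.
Qed.

Lemma point_neq u v : u != zero3 -> v != zero3 ->
  (point u != point v) = (cross u v != zero3).
Proof.
move=> u0 v0; congr (~~ _); apply/eqP/(cross_eq0P _ u0) => [e|[c E]].
  have /vlineP[c E] : rowv v \in point u by rewrite e memv_line.
  by exists c; apply: (can_inj rowvK); rewrite rowv_scale.
move: v0; rewrite E scale_eq0 negb_or => /andP[c0 _].
by rewrite point_scale.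
Qed.

Lemma line_neq u v : u != zero3 -> v != zero3 ->
  (line u != line v) = (cross u v != zero3).
Proof.
move=> u0 v0; apply/idP/idP; last first.
  (* If the lines were equal, their meet would be a line, of dimension at least 2, and also a point,
     of dimension at most 1. *)
  move/line_meet=> e; apply/eqP => E; move: e (dim_line v).
  by rewrite E capvv => ->; rewrite dim_vline; case: (_ != _).
apply: contraNN => /(cross_eq0P _ u0)[c E].
move: v0; rewrite E scale_eq0 negb_or => /andP[c0 _].
by rewrite line_scale.
Qed.

(** Two distinct lines meet in one point only: a vector on both is a multiple of [cross w w']. *)
Lemma common_points u v w w' : cross w w' != zero3 ->
  dot u w = 0 -> dot u w' = 0 -> dot v w = 0 -> dot v w' = 0 ->
  cross u v = zero3.
Proof.
move=> nz uw uw' vw vw'.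
have multiple (x : F * F * F) : dot x w = 0 -> dot x w' = 0 ->
    exists c, x = scale c (cross w w').
  move=> xw xw'; apply/(cross_eq0P _ nz).
  by rewrite crossC cross_cross xw xw' !mul0r !subr0 /scale /= !mulr0.
have [c ->] := multiple u uw uw'; have [d ->] := multiple v vw vw'.
rewrite cross_scale crossC cross_scale; case: (cross w w') => [[? ?] ?].
by rewrite /scale /cross /=; congr (_, _, _); ring.
Qed.

End Projective.

(* Labels of the construction and its coordinates as integer polynomials *)
Delimit Scope Z_scope with ZZ.

(* The label (k, 0) stands for the point P_k and (i, j) with j > 0 for the line
   through P_i and P_j. *)
Definition label : Type := (nat * nat)%type.

Definition is_point (k : label) : bool := k.2 == 0.

Definition point_labels : seq label := [seq (k, 0)%N | k <- iota 1 46].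

Definition line_labels : seq label :=
  [:: (1, 4); (2, 4); (3, 4); (2, 5); (3, 5); (6, 8); (7, 8); (1, 9); (1, 10);
      (13, 15); (14, 16); (17, 21); (18, 22); (19, 20); (2, 24); (3, 25);
      (11, 27); (12, 28)]%N.

(** P7P10 and P6P9 are absent from [line_labels], so nondegeneracy can be applied to them only under
    their listed names. *)
Definition alias (k : label) : label :=
  if k == (7, 10)%N then (7, 8)%N else if k == (6, 9)%N then (6, 8)%N else k.

(** Lookup by position makes the lists of points and lines convertible to images of the label
    lists. *)
Definition space (F : fieldType) (a b : F) (k : label) : {vspace 'rV[F]_3} :=
  nth 0%VS (B18_points a b ++ B18_lines a b ++ [:: P7P10 a b; P6P9 a b])
    (index k (point_labels ++ line_labels ++ [:: (7, 10); (6, 9)]%N)).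

(** The factors cancelled from cross products: a, a - 1, b - 1, a - b, (a + 1)b - 2a, (a + 1)b + a^2
    - 3a and (a + 1)b^2 - 4ab + a^2 + a. That they do not vanish is derived from nondegeneracy. *)
Definition factA : bpoly := [:: [:: 0; 1]]%ZZ.
Definition factA1 : bpoly := [:: [:: -1; 1]]%ZZ.
Definition factB1 : bpoly := [:: [:: -1]; [:: 1]]%ZZ.
Definition factAB : bpoly := [:: [:: 0; 1]; [:: -1]]%ZZ.
Definition factS : bpoly := [:: [:: 0; -2]; [:: 1; 1]]%ZZ.
Definition factQ : bpoly := [:: [:: 0; -3; 1]; [:: 1; 1]]%ZZ.
Definition factT : bpoly := [:: [:: 0; 1; 1]; [:: 0; -4]; [:: 1; 1]]%ZZ.

Definition C18_poly : bpoly :=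
  [:: [:: 0; 0; 0; -4; 6; -5; 1]; [:: 0; 0; 4; -1; 7]; [:: 0; -1; 3; -22; 1; -1];
      [:: 0; -4; 11; 12; 1]; [:: 1; -1; -4; -6]; [:: 0; 0; 1; 1]]%ZZ.

(* Result, two operands, and the factors which the coordinates of the cross
   product of the operands have in common. *)
Definition step : Type := (label * label * label * seq bpoly)%type.

Definition meet k i j gs : step := ((k, 0)%N, i, j, gs).
Definition join i j gs : step := ((i, j), (i, 0)%N, (j, 0)%N, gs).

Definition steps : seq step :=
  ([:: join 1 4 [::]; join 2 4 [::]; join 3 4 [::]; join 2 5 [::];
      join 3 5 [::]; meet 6 (2, 4) (3, 5) [::]; meet 7 (3, 4) (2, 5) [::];
      join 6 8 [::]; join 7 8 [::]; meet 9 (2, 5) (6, 8) [::];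
      meet 10 (3, 5) (7, 8) [::]; meet 11 (3, 4) (6, 8) [::];
      meet 12 (2, 4) (7, 8) [::]; join 1 9 [::]; join 1 10 [::];
      meet 13 (3, 4) (1, 9) [::]; meet 14 (2, 4) (1, 10) [::];
      meet 15 (1, 10) (6, 8) [:: factA1]; meet 16 (1, 9) (7, 8) [:: factA1];
      meet 17 (2, 4) (1, 9) [::]; meet 18 (3, 4) (1, 10) [::];
      join 13 15 [::]; join 14 16 [::]; meet 19 (2, 4) (13, 15) [::];
      meet 20 (3, 4) (14, 16) [::]; meet 21 (2, 5) (13, 15) [::];
      meet 22 (3, 5) (14, 16) [::]; meet 23 (1, 4) (13, 15) [:: factA1; factAB];
      join 7 10 [:: factA1; factA]; meet 24 (7, 10) (13, 15) [:: factA1; factS];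
      join 6 9 [:: factA1; factA]; meet 25 (6, 9) (14, 16) [:: factA1; factS];
      join 17 21 [:: factA1]; join 18 22 [:: factA1];
      join 19 20 [:: factA1; factAB; factT];
      meet 26 (17, 21) (1, 4) [:: factA1; factAB];
      meet 27 (3, 5) (17, 21) [:: factA]; meet 28 (18, 22) (2, 5) [:: factA];
      meet 29 (19, 20) (17, 21) [:: factQ]; meet 30 (19, 20) (18, 22) [:: factQ];
      meet 31 (3, 4) (17, 21) [::]; meet 32 (2, 4) (18, 22) [::];
      meet 33 (1, 10) (17, 21) [:: factA1; factAB; factQ];
      meet 34 (1, 9) (18, 22) [:: factA1; factAB; factQ];
      meet 35 (17, 21) (14, 16) [:: factA1; factAB; factQ];
      meet 36 (18, 22) (13, 15) [:: factA1; factAB; factQ];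
      meet 37 (19, 20) (1, 9) [:: factQ]; meet 38 (19, 20) (1, 10) [:: factQ];
      meet 39 (3, 5) (19, 20) [::]; meet 40 (2, 5) (19, 20) [::];
      join 2 24 [::]; join 3 25 [::]; join 11 27 [:: factA1];
      join 12 28 [:: factA1]; meet 41 (2, 24) (1, 10) [::];
      meet 42 (3, 25) (1, 9) [::]; meet 43 (1, 4) (11, 27) [:: factA1; factB1];
      meet 44 (2, 24) (6, 8) [::]; meet 45 (3, 25) (7, 8) [::];
      meet 46 (1, 4) (2, 24) [::]])%N.

Definition bcross : bpoly * bpoly * bpoly -> _ := cross_with bsub bmul.
Definition bdot : bpoly * bpoly * bpoly -> _ := dot_with badd bmul.
Definition bprod : seq bpoly -> bpoly := foldr bmul [:: [:: 1%ZZ]].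
Definition map3 T U (f : T -> U) (u : T * T * T) : U * U * U :=
  (f u.1.1, f u.1.2, f u.2).

Definition base_coords : seq (label * (bpoly * bpoly * bpoly)) :=
  let o := [:: [:: 1%ZZ]] in
  [:: ((1, 0)%N, (o, [::], [::])); ((2, 0)%N, ([::], o, [::]));
      ((3, 0)%N, ([::], [::], o)); ((4, 0)%N, (o, o, o));
      ((5, 0)%N, ([:: [:: 0; 1]%ZZ], o, o));
      ((8, 0)%N, ([:: [::]; [:: 1%ZZ]], o, o))].

Definition lookup (s : seq (label * (bpoly * bpoly * bpoly))) (k : label) :=
  nth ([::], [::], [::]) (unzip2 s) (index k (unzip1 s)).

(** Tabulated once, at definition time. Exactness of the divisions is not assumed here; [step_check]
    verifies it by multiplying back. *)
Definition coords : seq (label * (bpoly * bpoly * bpoly)) :=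
  Eval vm_compute in
  foldl (fun s st => let: (k, i, j, gs) := st in
           rcons s (k, map3 (bdiv^~ (bprod gs))
                         (bcross (lookup s i) (lookup s j))))
    base_coords steps.

Definition coords_of : label -> bpoly * bpoly * bpoly := lookup coords.

Definition beq3 (u v : bpoly * bpoly * bpoly) : bool :=
  [&& bisz (bsub u.1.1 v.1.1), bisz (bsub u.1.2 v.1.2) & bisz (bsub u.2 v.2)].

Definition step_check (seen : seq label) (st : step) : bool :=
  let: (k, i, j, gs) := st in
  let i' := alias i in
  [&& is_point i == ~~ is_point k, is_point j == is_point i,
      all (mem seen) [:: i; j; i'], all (mem (point_labels ++ line_labels)) [:: i'; j],
      is_point i' == is_point i, i' != j, coords_of i == coords_of i' &
      beq3 (bcross (coords_of i) (coords_of j)) (map3 (bmul (bprod gs)) (coords_of k))].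

Fixpoint steps_check (seen : seq label) (sts : seq step) : bool :=
  if sts is st :: sts' then
    step_check seen st && steps_check (st.1.1.1 :: seen) sts'
  else all (mem seen) (point_labels ++ line_labels).

Opaque coords_of.

(** * Evaluation of the coordinate table *)

Section Vec.

Context (R : comNzRingType) (phi : {rmorphism Z -> R}) (a b : R).

Definition vec_at (k : label) : R * R * R := map3 (beval phi a b) (coords_of k).

Lemma map3_cross u v :
  map3 (beval phi a b) (bcross u v) =
  cross (map3 (beval phi a b) u) (map3 (beval phi a b) v).
Proof.
case: u v => [[? ?] ?] [[? ?] ?].
by rewrite /map3 /cross /= !bevalB !bevalM.
Qed.

Lemma beval_dot u v :
  beval phi a b (bdot u v) =
  dot (map3 (beval phi a b) u) (map3 (beval phi a b) v).
Proof.
case: u v => [[? ?] ?] [[? ?] ?].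
by rewrite /map3 /dot /= !bevalD !bevalM.
Qed.

Lemma map3_scale g u :
  map3 (beval phi a b) (map3 (bmul g) u) =
  scale (beval phi a b g) (map3 (beval phi a b) u).
Proof. by rewrite /map3 /scale /= !bevalM. Qed.

Lemma beq3_map3 u v :
  beq3 u v -> map3 (beval phi a b) u = map3 (beval phi a b) v.
Proof.
case/and3P=> /(beval_isz phi a b) + /(beval_isz phi a b) + /(beval_isz phi a b).
rewrite !bevalB /map3.
by move=> /subr0_eq -> /subr0_eq -> /subr0_eq ->.
Qed.

Lemma vec_dot0 k l :
  bisz (bdot (coords_of k) (coords_of l)) -> dot (vec_at k) (vec_at l) = 0.
Proof. by move/(beval_isz phi a b); rewrite beval_dot. Qed.

End Vec.

(** * The tabulated vectors describe the points and lines of the construction *)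

Section Validity.

Context (F : fieldType) (a b : F).

Local Notation zero3 := ((0, 0, 0) : F * F * F).
Local Notation "'evF'" := (beval (@of_Z F) a b).
Local Notation vec := (vec_at (@of_Z F) a b).

Definition span_of (k : label) (v : F * F * F) : {vspace 'rV[F]_3} :=
  if is_point k then point v else line v.

Definition valid (k : label) : Prop :=
  vec k != zero3 /\ space a b k = span_of k (vec k).

Definition step_spec (st : step) : Prop :=
  let: (k, i, j, _) := st in
  space a b k = if is_point k then (space a b i :&: space a b j)%VS
                else (space a b i + space a b j)%VS.

Lemma steps_spec : foldr (fun st P => step_spec st /\ P) True steps.
Proof. by do ![split]. Qed.

Definition all_valid : Prop :=
  {in point_labels ++ line_labels, forall k, valid k}.

(** The disjunction admits both sources: distinct subspaces in a nondegenerate configuration, or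
    nonproportional vectors. For valid labels the two alternatives agree. *)
Definition separated : Prop :=
  {in point_labels ++ line_labels &, forall k l,
    is_point k = is_point l -> k != l ->
    space a b k != space a b l \/ cross (vec k) (vec l) != zero3}.

Lemma base_valid : {in unzip1 base_coords, forall k, valid k}.
Proof.
have ev0 : evF [::] = 0 by [].
have ev1 : evF [:: [:: 1%ZZ]] = 1 by rewrite /beval /ueval /= !mul0r !add0r.
have evA : evF [:: [:: 0; 1]]%ZZ = a.
  by rewrite /beval /ueval /= !mul0r !add0r mul1r [of_Z _ _]rmorph0 addr0.
have evB : evF [:: [::]; [:: 1]]%ZZ = b.
  by rewrite /beval /ueval /= !mul0r !add0r mul1r addr0.
have o0 := oner_eq0 F.
have base k p q r x y z : coords_of k = (p, q, r) ->
    evF p = x -> evF q = y -> evF r = z -> space a b k = pt x y z ->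
    is_point k -> (x == 1) || (y == 1) || (z == 1) -> valid k.
  move=> e ex ey ez s kp nz; split; rewrite /span_of ?kp /vec_at e /map3 /=
    ex ey ez // !xpair_eqE.
  by case/orP: nz => [/orP[]|] /eqP->; rewrite o0 ?andbF.
have cE k u : coords_of k == u -> coords_of k = u by move/eqP.
move=> k; rewrite /unzip1 /= !inE.
case/or4P => [/eqP->|/eqP->|/eqP->|/or3P[]/eqP->].
- apply: (base _ _ _ _ _ _ _ (cE (1, 0)%N _ _) ev1 ev0 ev0);
    [by vm_compute | by [] | by [] |].
  by rewrite eqxx ?orbT.
- apply: (base _ _ _ _ _ _ _ (cE (2, 0)%N _ _) ev0 ev1 ev0);
    [by vm_compute | by [] | by [] |].
  by rewrite eqxx ?orbT.
- apply: (base _ _ _ _ _ _ _ (cE (3, 0)%N _ _) ev0 ev0 ev1);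
    [by vm_compute | by [] | by [] |].
  by rewrite eqxx ?orbT.
- apply: (base _ _ _ _ _ _ _ (cE (4, 0)%N _ _) ev1 ev1 ev1);
    [by vm_compute | by [] | by [] |].
  by rewrite eqxx ?orbT.
- apply: (base _ _ _ _ _ _ _ (cE (5, 0)%N _ _) evA ev1 ev1);
    [by vm_compute | by [] | by [] |].
  by rewrite eqxx ?orbT.
- apply: (base _ _ _ _ _ _ _ (cE (8, 0)%N _ _) evB ev1 ev1);
    [by vm_compute | by [] | by [] |].
  by rewrite eqxx ?orbT.
Qed.

Lemma valid_neq k l : is_point k = is_point l -> valid k -> valid l ->
  (space a b k != space a b l) = (cross (vec k) (vec l) != zero3).
Proof.
rewrite /valid /span_of => -> [k0 ->] [l0 ->].
by case: ifP => _; [exact: point_neq k0 l0 | exact: line_neq k0 l0].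
Qed.

Lemma valid_le k l : is_point k -> ~~ is_point l -> valid k -> valid l ->
  (space a b k <= space a b l)%VS = (dot (vec k) (vec l) == 0).
Proof.
by rewrite /valid /span_of => -> /negPf -> [_ ->] [_ ->]; apply: point_line.
Qed.

Lemma step_valid seen st : separated -> step_check seen st -> step_spec st ->
  {in seen, forall k, valid k} ->
  valid st.1.1.1 /\ evF (bprod st.2) != 0.
Proof.
case: st => [[[k i] j] gs] sep /=; set i' := alias i.
case/and5P=> /eqP pi /eqP pj /and4P[iS jS i'S _] /and3P[i'L jL _].
case/and4P=> /eqP pi' i'j /eqP ci /(beq3_map3 (@of_Z F) a b).
rewrite map3_cross map3_scale => cE E vS.
have [vi [vj vi']] : valid i /\ valid j /\ valid i'.
  by split; [exact: vS | split; [exact: vS | exact: vS]].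
have nz : cross (vec i) (vec j) != zero3.
  have -> : vec i = vec i' by rewrite /vec_at ci.
  have pij : is_point i' = is_point j by rewrite pi' pj.
  case: (sep i' j i'L jL pij i'j) => //.
  by rewrite (valid_neq pij vi' vj).
have kE : cross (vec i) (vec j) = scale (evF (bprod gs)) (vec k) by [].
move: (nz); rewrite kE scale_eq0 negb_or => /andP[g0 k0].
split=> //; split=> //; rewrite E /span_of.
case: vi vj => [_ ->] [_ ->]; rewrite /span_of pj pi; case: (is_point k) => /=.
  by rewrite line_meet // kE point_scale.
by rewrite point_join // kE line_scale.
Qed.

Lemma valid_of_separated : separated ->
  all_valid /\ {in steps, forall st, evF (bprod st.2) != 0}.
Proof.
move=> sep; have chk : steps_check (unzip1 base_coords) steps.
  by vm_cast_no_check (erefl true).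
move: chk steps_spec base_valid.
elim: steps (unzip1 base_coords) => [|st sts IH] seen.
  move=> h _ v; split=> // k kL; apply: v.
  exact: (allP (h : all (mem seen) (point_labels ++ line_labels))).
case/andP=> chk chks [sp sps] v; have [vk g0] := step_valid sep chk sp v.
have [|? gs] := IH _ chks sps; last first.
  by split=> // st'; rewrite inE => /predU1P[->//|]; apply: gs.
by move=> k; rewrite inE => /predU1P[->//|]; apply: v.
Qed.

End Validity.

(** * Nondegeneracy in terms of coordinates *)

Section Degeneracy.

Context (F : fieldType) (a b : F).

Local Notation zero3 := ((0, 0, 0) : F * F * F).
Local Notation "'evF'" := (beval (@of_Z F) a b).
Local Notation vec := (vec_at (@of_Z F) a b).
Local Notation space := (space a b).

Lemma B18_pointsE : B18_points a b = map space point_labels.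
Proof. by []. Qed.

Lemma B18_linesE : B18_lines a b = map space line_labels.
Proof. by []. Qed.

Lemma is_point_point k : k \in point_labels -> is_point k.
Proof. by apply/allP: k. Qed.

Lemma is_point_line k : k \in line_labels -> ~~ is_point k.
Proof. by apply/allP: k. Qed.

Lemma is_pointE k : k \in point_labels ++ line_labels ->
  k \in if is_point k then point_labels else line_labels.
Proof.
rewrite mem_cat => /orP[kP|kL]; first by rewrite (is_point_point kP).
by rewrite (negPf (is_point_line kL)).
Qed.

Lemma uniq_map_inj (T U : eqType) (f : T -> U) s :
  uniq (map f s) -> {in s &, injective f}.
Proof.
elim: s => //= x s IH /andP[xN /IH fI] y z; rewrite !inE.
move=> /predU1P[->|ys] /predU1P[->|zs] // e; last exact: fI.
  by case/negP: xN; rewrite e map_f.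
by case/negP: xN; rewrite -e map_f.
Qed.

Lemma separated_of_nondegenerate : ~~ B18_degenerate a b -> separated a b.
Proof.
rewrite negbK B18_pointsE B18_linesE => /andP[/uniq_map_inj uP /uniq_map_inj uL].
move=> k l /is_pointE kL /is_pointE lL e; rewrite e in kL.
move=> kl; left; apply: contraNneq kl => E; apply/eqP.
by case: (is_point l) kL lL => kL lL; [apply: uP | apply: uL].
Qed.

Definition independent : Prop :=
  {in point_labels ++ line_labels &, forall k l,
    is_point k = is_point l -> k != l -> cross (vec k) (vec l) != zero3}.

(** A purely algebraic criterion for nondegeneracy, used for an explicit point and for the
    finiteness of the degenerate points on the curve. *)
Lemma nondegenerate_of_independent :
  independent -> ~~ B18_degenerate a b /\ all_valid a b.
Proof.
move=> ind; have [|v _] := @valid_of_separated F a b.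
  by move=> k l kL lL e kl; right; apply: ind.
split=> //; rewrite negbK B18_pointsE B18_linesE.
have inj s : {subset s <= point_labels ++ line_labels} ->
    {in s &, forall k l, is_point k = is_point l} -> {in s &, injective space}.
  move=> sub eqp k l ks ls /eqP; apply: contraTeq => kl.
  by rewrite (valid_neq (eqp _ _ ks ls)); [apply: ind; rewrite ?eqp|..]; auto.
apply/andP; split; rewrite map_inj_in_uniq //; apply: inj.
- by move=> k; rewrite mem_cat => ->.
- by move=> k l /is_point_point-> /is_point_point->.
- by move=> k; rewrite mem_cat orbC => ->.
- by move=> k l /is_point_line/negPf-> /is_point_line/negPf->.
Qed.

Lemma triple_pointE k : ~~ B18_degenerate a b -> all_valid a b ->
  k \in point_labels ->
  triple_point (B18_lines a b) (space k) =
  (3 <= count (fun l => dot (vec k) (vec l) == 0)%R line_labels)%N.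
Proof.
rewrite negbK => /andP[_ uL] v kP.
rewrite /triple_point undup_id // B18_linesE count_map.
congr (_ <= _)%N; apply: eq_in_count => l lL /=.
apply: valid_le (is_point_point kP) (is_point_line lL) _ _.
  by apply: v; rewrite mem_cat kP.
by apply: v; rewrite mem_cat lL orbT.
Qed.

End Degeneracy.

(** * Triple points, the conditions and the curve *)

Definition automatic_labels : seq label :=
  [seq (k, 0)%N | k <- iota 1 28 ++ [:: 33; 34; 41; 42; 43; 46]%N].

(** Each doubtful point with the line that its condition adds to the two lines defining it. *)
Definition third_lines : seq (label * label) :=
  [:: (29, 0, (6, 8)); (30, 0, (7, 8)); (31, 0, (2, 24)); (32, 0, (3, 25));
      (35, 0, (12, 28)); (36, 0, (11, 27)); (37, 0, (11, 27)); (38, 0, (12, 28));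
      (39, 0, (2, 24)); (40, 0, (3, 25)); (44, 0, (12, 28)); (45, 0, (11, 27))]%N.

Definition doubtful_labels : seq label := unzip1 third_lines.

Section Curve.

Context (F : fieldType) (a b : F).

Local Notation zero3 := ((0, 0, 0) : F * F * F).
Local Notation "'evF'" := (beval (@of_Z F) a b).
Local Notation vec := (vec_at (@of_Z F) a b).
Local Notation space := (space a b).

Lemma B18_automatic_pointsE : B18_automatic_points a b = map space automatic_labels.
Proof. by []. Qed.

Lemma B18_doubtful_pointsE : B18_doubtful_points a b = map space doubtful_labels.
Proof. by []. Qed.

Lemma beval_C18 : evF C18_poly = C18 a b.
Proof. by rewrite /beval /ueval /C18 /= /of_Z /= !NegzE /Pos.to_nat /=; ring. Qed.

(** Turns an equation between a point and a threefold intersection into incidence with the third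
    line. *)
Lemma capv_idP (U T W : {vspace 'rV[F]_3}) :
  (forall x, (x \in W) = (x \in T) && (x \in U)) -> (U = W <-> (U <= T)%VS).
Proof.
move=> WE; have -> : W = (T :&: U)%VS by apply/vspaceP => x; rewrite WE memv_cap.
by split=> [->|/capv_idPr //]; apply: capvSl.
Qed.

Lemma and_iff_and (A B C D : Prop) :
  (A <-> C) -> (B <-> D) -> (A /\ B <-> C /\ D).
Proof. by tauto. Qed.

Lemma foldr_and (T : eqType) (P : T -> Prop) s :
  foldr (fun x Q => P x /\ Q) True s <-> {in s, forall x, P x}.
Proof.
elim: s => [|x s IH] //=; split=> [[Px /IH Ps] y|Ps].
  by rewrite inE => /predU1P[->|/Ps].
split; first by apply: Ps; rewrite mem_head.
by apply/IH => y ys; apply: Ps; rewrite inE ys orbT.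
Qed.

Lemma B18_conditionsE :
  B18_conditions a b <-> {in third_lines, forall p, (space p.1 <= space p.2)%VS}.
Proof.
rewrite -foldr_and /B18_conditions; cbn [foldr third_lines].
have andT (P Q : Prop) : (P <-> Q) -> (P <-> Q /\ True) by tauto.
do 11![apply: and_iff_and; first by apply: capv_idP => x;
  rewrite ?/P29 ?/P30 ?/P31 ?/P32 ?/P35 ?/P36 ?/P37 ?/P38 ?/P39 ?/P40 ?/P44;
  rewrite !memv_cap; do 3![case: (_ \in _)]].
apply: andT; apply: capv_idP => x.
by rewrite /P45 !memv_cap; do 3![case: (_ \in _)].
Qed.

Lemma dot_on_curve : C18 a b = 0 ->
  {in third_lines, forall p, dot (vec p.1) (vec p.2) = 0}.
Proof.
rewrite -beval_C18 => C0 p pT.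
(* The cofactor of [C18] is found by division and certified by multiplying back. *)
have : all (fun p => let d := bdot (coords_of p.1) (coords_of p.2) in
    bisz (bsub d (bmul C18_poly (bdiv d C18_poly)))) third_lines.
  by vm_cast_no_check (erefl true).
move/allP/(_ p pT)/(beval_isz (@of_Z F) a b).
by rewrite bevalB bevalM C0 mul0r subr0 beval_dot.
Qed.

Lemma curve_of_P37 : {in steps, forall st, evF (bprod st.2) != 0} ->
  dot (vec (37, 0)%N) (vec (11, 27)%N) = 0 -> C18 a b = 0.
Proof.
(* The dot product equals minus (a - 1)^3 ((a + 1)b - 2a) times [C18]. *)
move=> gs d0; pose g := bmul factA1 (bmul factA1 (bmul factA1 factS)).
have /(beval_isz (@of_Z F) a b) : bisz (badd
    (bdot (coords_of (37, 0)%N) (coords_of (11, 27)%N)) (bmul C18_poly g)).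
  by vm_cast_no_check (erefl true).
rewrite bevalD beval_dot d0 add0r => /eqP; rewrite bevalM beval_C18.
(* Both factors of the cofactor were cancelled in the step for P24, so they are nonzero. *)
have : evF (bmul factA1 (bmul factS [:: [:: 1%ZZ]])) != 0.
  exact: (gs (meet 24 (7, 10) (13, 15) [:: factA1; factS])%N).
rewrite !bevalM !mulf_eq0 !negb_or => /and3P[/negPf-> /negPf-> _].
by rewrite !orbF => /eqP.
Qed.

Hypothesis nondeg : ~~ B18_degenerate a b.

Let sep : separated a b := separated_of_nondegenerate nondeg.
Let valP : all_valid a b := (valid_of_separated sep).1.

Lemma independent_of_nondegenerate : independent a b.
Proof.
move=> k l kL lL e kl; have [|//] := sep kL lL e kl.
by rewrite (valid_neq e (valP kL) (valP lL)).
Qed.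

Lemma automatic_triple k : k \in automatic_labels ->
  triple_point (B18_lines a b) (space k).
Proof.
move=> kA.
have : all (fun k => (k \in point_labels) && (3 <= count (fun l =>
    bisz (bdot (coords_of k) (coords_of l))) line_labels)%N) automatic_labels.
  by vm_cast_no_check (erefl true).
case/allP/(_ k kA)/andP => kP c3; rewrite triple_pointE //.
apply: leq_trans c3 _; apply: sub_count => l /(vec_dot0 (@of_Z F) a b) ->.
exact: eqxx.
Qed.

Lemma third_lines_labels p : p \in third_lines ->
  p.1 \in point_labels /\ p.2 \in line_labels.
Proof.
move=> pT; apply/andP; move: p pT; apply/allP.
by vm_cast_no_check (erefl true).
Qed.

Lemma third_line_le p : p \in third_lines ->
  (space p.1 <= space p.2)%VS = (dot (vec p.1) (vec p.2) == 0).
Proof.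
case/third_lines_labels => kP lL.
apply: valid_le (is_point_point kP) (is_point_line lL) _ _.
  by apply: valP; rewrite mem_cat kP.
by apply: valP; rewrite mem_cat lL orbT.
Qed.

Lemma doubtful_triple p : p \in third_lines -> dot (vec p.1) (vec p.2) = 0 ->
  triple_point (B18_lines a b) (space p.1).
Proof.
move=> pT d0.
have : all (fun p => 3 <= count (fun l => bisz (bdot (coords_of p.1) (coords_of l))
    || (l == p.2)) line_labels)%N third_lines.
  by vm_cast_no_check (erefl true).
move/allP/(_ p pT) => c3; rewrite triple_pointE //; last first.
  by case/third_lines_labels: pT.
apply: leq_trans c3 _; apply: sub_count => l.
by case/orP => [/(vec_dot0 (@of_Z F) a b) ->|/eqP->]; rewrite ?d0 eqxx.
Qed.

(* Any line other than P1P9, P19P20 and P11P27 meets P1P9 or P19P20 in a point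
   of the construction different from P37. *)
Lemma P37_triple : triple_point (B18_lines a b) (space (37, 0)%N) ->
  dot (vec (37, 0)%N) (vec (11, 27)%N) = 0.
Proof.
rewrite triple_pointE // => c3; apply/eqP; apply: contraLR c3 => d0.
rewrite -ltnNge ltnS; pose two : seq label := [:: (1, 9); (19, 20)]%N.
apply: (@leq_trans (count (mem two) line_labels)); last first.
  by vm_cast_no_check (erefl true).
have /eq_in_count -> : {in line_labels,
    (fun l => dot (vec (37, 0)%N) (vec l) == 0) =1
    (fun l => (l \in line_labels) && (dot (vec (37, 0)%N) (vec l) == 0))}.
  by move=> l lL; rewrite lL.
apply: sub_count => l /andP[lL /eqP dl].
have : all (fun l => [|| l \in two, l == (11, 27)%N | has (fun m => has (fun n =>
    [&& m != (37, 0)%N, l != n, bisz (bdot (coords_of m) (coords_of l)),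
        bisz (bdot (coords_of m) (coords_of n)) &
        bisz (bdot (coords_of (37, 0)%N) (coords_of n))]) two) point_labels])
    line_labels by vm_cast_no_check (erefl true).
move/allP/(_ l lL) => /or3P[//|/eqP le|]; first by rewrite -le dl eqxx in d0.
case/hasP => m mP /hasP[n nT] /and5P[m37 ln].
move=> /(vec_dot0 (@of_Z F) a b) dml /(vec_dot0 (@of_Z F) a b) dmn.
move=> /(vec_dot0 (@of_Z F) a b) dn.
have nL : n \in line_labels.
  by move: n nT {ln dmn dn}; apply/allP; vm_cast_no_check (erefl true).
have pE k : k \in point_labels -> k \in point_labels ++ line_labels.
  by rewrite mem_cat => ->.
have lE k : k \in line_labels -> k \in point_labels ++ line_labels.
  by rewrite mem_cat orbC => ->.
have e1 : is_point l = is_point n.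
  by rewrite (negPf (is_point_line lL)) (negPf (is_point_line nL)).
have e2 : is_point m = is_point (37, 0)%N by rewrite is_point_point.
have := independent_of_nondegenerate (pE _ mP) (pE (37, 0)%N isT) e2 m37.
have ind := independent_of_nondegenerate (lE _ lL) (lE _ nL) e1 ln.
by rewrite (common_points ind dml dmn dl dn) eqxx.
Qed.

End Curve.

(** * Change of ring, a generic configuration, and the equivalence with the curve *)

Section Specialization.

Context (R S : comNzRingType) (h : {rmorphism R -> S}).

Lemma cross_map3 u v : cross (map3 h u) (map3 h v) = map3 h (cross u v).
Proof.
by case: u v => [[? ?] ?] [[? ?] ?]; rewrite /cross /map3 /= !rmorphB !rmorphM.
Qed.

Lemma dot_map3 u v : dot (map3 h u) (map3 h v) = h (dot u v).
Proof.
by case: u v => [[? ?] ?] [[? ?] ?]; rewrite /dot /map3 /= !rmorphD !rmorphM.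
Qed.

Lemma vec_map3 (phi : {rmorphism Z -> R}) (psi : {rmorphism Z -> S}) a b k :
  h \o phi =1 psi -> vec_at psi (h a) (h b) k = map3 h (vec_at phi a b k).
Proof. by move=> e; rewrite /vec_at /map3 /= !(rmorph_beval _ _ _ e). Qed.

End Specialization.

Lemma of_Z_eq0 (F : fieldType) (z : Z) :
  [pchar F] =i pred0 -> (of_Z F z == 0) = (z == 0).
Proof.
move/pcharf0P => n0; rewrite /of_Z -[z]int_of_ZK.
case: (int_of_Z z) => n; rewrite Z_of_intK.
  by rewrite -pmulrn n0; case: n.
rewrite NegzE mulrNz oppr_eq0 -pmulrn n0 /=.
by case: n.
Qed.

(** The parameters a = 2, b = 3 work: the required nonvanishings are decided in [Z], and
    characteristic 0 preserves them. *)
Lemma generic_nondegenerate (F : fieldType) : [pchar F] =i pred0 ->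
  exists a b : F, [/\ a != 1, b != 1, a != b, ~~ B18_degenerate a b &
    forall Q, Q \in B18_doubtful_points a b ->
      ~~ triple_point (B18_lines a b) Q].
Proof.
move=> char0; pose w := vec_at (idfun : Z -> Z) 2 3.
have neqZ x y : (of_Z F x != of_Z F y) = (x != y).
  by rewrite -subr_eq0 -rmorphB of_Z_eq0 // subr_eq0.
have wE k : vec_at (@of_Z F) (of_Z F 2) (of_Z F 3) k = map3 (of_Z F) (w k).
  exact: vec_map3.
have ind : independent (of_Z F 2) (of_Z F 3).
  move=> k l kL lL e kl; rewrite !wE cross_map3.
  have : all (fun k => all (fun l => [|| is_point k != is_point l, k == l |
      cross (w k) (w l) != (0, 0, 0)]) (point_labels ++ line_labels))
      (point_labels ++ line_labels) by vm_cast_no_check (erefl true).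
  move/allP/(_ k kL)/allP/(_ l lL); rewrite e eqxx (negPf kl) /=.
  apply: contraNN; case: (cross (w k) (w l)) => [[x y] z].
  by rewrite /map3 /= !xpair_eqE !of_Z_eq0.
have [nd v] := nondegenerate_of_independent ind.
exists (of_Z F 2), (of_Z F 3); split; rewrite ?neqZ // -?(rmorph1 (@of_Z F)) ?neqZ //.
move=> Q; rewrite B18_doubtful_pointsE => /mapP[k kD ->].
have : all (fun k => (k \in point_labels) && (count (fun l => dot (w k) (w l) == 0)%R
    line_labels <= 2)%N) doubtful_labels by vm_cast_no_check (erefl true).
case/allP/(_ k kD)/andP => kP c2; rewrite triple_pointE // -ltnNge ltnS.
apply: leq_trans c2; apply: sub_count => l.
by rewrite !wE dot_map3 of_Z_eq0.
Qed.

(** The cycle is: all points triple, so P37 triple, so [C18] zero, so all conditions, so all points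
    triple. The condition at P37 alone also gives the curve. *)
Lemma triple_iff_curve (F : fieldType) (a b : F) : ~~ B18_degenerate a b ->
  [/\ forall Q, Q \in B18_automatic_points a b ->
        triple_point (B18_lines a b) Q,
      (forall Q, Q \in B18_points a b -> triple_point (B18_lines a b) Q)
        <-> B18_conditions a b &
      B18_conditions a b <-> C18 a b = 0].
Proof.
move=> nd.
have auto Q : Q \in B18_automatic_points a b -> triple_point (B18_lines a b) Q.
  by rewrite B18_automatic_pointsE => /mapP[k kA ->]; apply: automatic_triple.
have conds : C18 a b = 0 -> B18_conditions a b.
  move=> C0; apply/B18_conditionsE => p pT.
  by rewrite third_line_le // dot_on_curve.
have curve : dot (vec_at (@of_Z F) a b (37, 0)%N) (vec_at (@of_Z F) a b (11, 27)%N) = 0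
    -> C18 a b = 0.
  by apply: curve_of_P37; case: (valid_of_separated (separated_of_nondegenerate nd)).
split; [exact: auto | split=> [all3|] | split; last exact: conds].
- apply/conds/curve/P37_triple => //; apply: all3.
  by rewrite B18_pointsE map_f.
- move/B18_conditionsE => cs Q; rewrite B18_pointsE => /mapP[k kP ->].
  have : all (fun k => (k \in automatic_labels) || (k \in doubtful_labels))
    point_labels by vm_cast_no_check (erefl true).
  case/allP/(_ k kP)/orP => [|/mapP[p pT ->]]; first exact: automatic_triple.
  move: (cs p pT); rewrite (third_line_le nd pT) => /eqP.
  exact: doubtful_triple.
move/B18_conditionsE/(_ ((37, 0), (11, 27))%N isT).
by rewrite third_line_le // => /eqP; apply: curve.
Qed.

(** * Finiteness of zero sets and specialization of integer polynomials *)

Lemma finite_bigcup (T U : eqType) (P : T -> U -> Prop) (ts : seq T) :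
  {in ts, forall t, exists s : seq U, forall x, P t x -> x \in s} ->
  exists s : seq U, {in ts, forall t x, P t x -> x \in s}.
Proof.
elim: ts => [|t ts IH] fin; first by exists [::].
have [s1 s1P] := fin t (mem_head t ts).
have [|s2 s2P] := IH; first by move=> u uts; apply: fin; rewrite inE uts orbT.
exists (s1 ++ s2) => u; rewrite inE => /predU1P[->|uts] x Px; rewrite mem_cat.
  by rewrite s1P.
by rewrite (s2P u) ?orbT.
Qed.

(** Roots are split off one at a time; excluded middle decides whether one remains. *)
Lemma finite_roots (F : fieldType) (p : {poly F}) : p != 0 ->
  exists s : seq F, forall x, root p x -> x \in s.
Proof.
have [n] := ubnP (size p); elim: n p => // n IH p pn p0.
case: (classic (exists x, root p x)) => [[x px]|no]; last first.
  by exists [::] => x px; case: no; exists x.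
have [q pE] := factor_theorem _ _ px.
have q0 : q != 0 by apply: contraNneq p0 => q0; rewrite pE q0 mul0r.
have [|s sP] := IH q _ q0.
  by rewrite pE size_Mmonic ?monicXsubC // size_XsubC addn2 /= ltnS in pn.
exists (x :: s) => y; rewrite pE rootM root_XsubC inE.
by case/orP => [/sP->|->] //; rewrite orbT.
Qed.

Section Specialize.

Context (R : comNzRingType).

(** In [{poly {poly int}}] the inner variable stands for a and the outer one for b. *)
Definition specialize1 (a : R) : {poly int} -> R :=
  horner_eval a \o map_poly intr.

HB.instance Definition _ (a : R) := GRing.RMorphism.copy (specialize1 a)
  (horner_eval a \o map_poly (intr : int -> R)).

Definition specialize (a b : R) : {poly {poly int}} -> R :=
  horner_eval b \o map_poly (specialize1 a).

HB.instance Definition _ (a b : R) := GRing.RMorphism.copy (specialize a b)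
  (horner_eval b \o map_poly (specialize1 a)).

Lemma specializeC a b p : specialize a b p%:P = specialize1 a p.
Proof. by rewrite /specialize /= map_polyC /horner_eval hornerC. Qed.

Lemma specialize1X a : specialize1 a 'X = a.
Proof. by rewrite /specialize1 /= map_polyX /horner_eval hornerX. Qed.

Lemma specializeX a b : specialize a b 'X = b.
Proof. by rewrite /specialize /= map_polyX /horner_eval hornerX. Qed.

Lemma specialize_beval a b p :
  specialize a b (beval (@of_Z {poly {poly int}}) 'X%:P 'X p)
  = beval (@of_Z R) a b p.
Proof.
rewrite (@rmorph_beval _ _ _ (@of_Z R) (specialize a b)); last first.
  by move=> z; rewrite /= /of_Z rmorph_int.
by congr beval; rewrite /= ?specializeC ?specialize1X ?specializeX.
Qed.

Lemma beval_Poly (a : R) p :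
  beval (@of_Z {poly R}) a%:P 'X p = Poly (map (ueval (@of_Z R) a) p).
Proof.
rewrite /beval; elim: p => //= c p ->; rewrite cons_poly_def; congr (_ + _).
rewrite /ueval; elim: c => //= z c ->.
by rewrite rmorphD rmorphM /= /of_Z rmorph_int.
Qed.

End Specialize.

Lemma C18_poly_eval (F : fieldType) (a b : F) :
  (beval (@of_Z {poly F}) a%:P 'X C18_poly).[b] = C18 a b.
Proof.
rewrite -beval_C18 beval_Poly.
by elim: C18_poly => [|c p IH] /=; rewrite ?horner0 // horner_cons IH.
Qed.

(** The coefficients of b^5 and b^4 are a^2 (a + 1) and 1 - a - 4a^2 - 6a^3. They have no common
    zero, the second being 1 at a = 0 and 4 at a = -1. *)
Lemma C18_poly_neq0 (F : fieldType) (a : F) : [pchar F] =i pred0 ->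
  beval (@of_Z {poly F}) a%:P 'X C18_poly != 0.
Proof.
move=> char0; apply/eqP; rewrite beval_Poly => P0.
have c5 : a ^+ 2 * (a + 1) = 0.
  rewrite -[RHS](coef0 _ 5) -P0 coef_Poly /ueval /= /of_Z /= /Pos.to_nat /=.
  by ring.
have c4 : 1 - a - 4 * a ^+ 2 - 6 * a ^+ 3 = 0.
  rewrite -[RHS](coef0 _ 4) -P0 coef_Poly /ueval /= /of_Z /= !NegzE.
  by rewrite /Pos.to_nat /=; ring.
move/eqP: c5; rewrite mulf_eq0 sqrf_eq0 addr_eq0.
case/orP => /eqP aE; move/eqP: c4; rewrite aE.
  by rewrite !expr0n /= !mulr0 !subr0 oner_eq0.
rewrite (_ : _ - _ = 4%:R); last by ring.
by move/pcharf0P: char0 => ->.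
Qed.

(** * Reduction modulo a prime and elimination of b *)

Lemma of_Z_mod (R : nzRingType) (p : nat) (z : Z) : p \in [pchar R] ->
  of_Z R z = (Z.to_nat (z mod Z.of_nat p))%:R.
Proof.
move=> pP; have p0 := prime_gt0 (pcharf_prime pP).
have of_p : of_Z R (Z.of_nat p) = 0.
  by rewrite /of_Z (Z_of_intK p) -pmulrn pcharf0.
have [zE r0] : z = Z.of_nat p * (z / Z.of_nat p)%ZZ + (z mod Z.of_nat p)%ZZ /\
    (0 <= z mod Z.of_nat p)%ZZ.
  have p1 : Z.of_nat p <> 0%ZZ by clear -p0; lia.
  split; first exact: Z.div_mod.
  by case: (Z.mod_pos_bound z (Z.of_nat p)) => //; clear -p0; lia.
rewrite {1}zE rmorphD rmorphM /= of_p mul0r add0r.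
rewrite -[in LHS](Z2Nat.id _ r0) /of_Z (Z_of_intK (Z.to_nat _)).
by rewrite -pmulrn.
Qed.

Lemma of_Z_mod_eq0 (R : nzRingType) (p : nat) (z : Z) : p \in [pchar R] ->
  (of_Z R z == 0) = ((z mod Z.of_nat p)%ZZ == 0).
Proof.
move=> pP; have p0 := prime_gt0 (pcharf_prime pP).
rewrite (of_Z_mod z pP) -(dvdn_pcharf pP).
have [r0 rp] : (0 <= z mod Z.of_nat p < Z.of_nat p)%ZZ.
  by apply: Z.mod_pos_bound; clear -p0; lia.
move: (z mod _)%ZZ r0 rp => r r0 rp.
case: (posnP (Z.to_nat r)) => [rE|rE].
  by rewrite rE dvdn0; clear -rE r0; lia.
by rewrite gtnNdvd //; clear -rE r0 rp p0; lia.
Qed.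

(* Specializing the first variable so that p splits into distinct linear
   factors, none of which divides q, shows that a resultant is nonzero. A
   multiple of p is added to q to keep its leading coefficient from vanishing. *)
Lemma eliminant (K : fieldType) (x : K) (rs : seq K) (p q : {poly {poly int}}) :
  (0 < size rs)%N -> uniq rs -> size p = (size rs).+1 ->
  specialize1 x (lead_coef p) != 0 ->
  {in rs, forall y, specialize x y p = 0 /\ specialize x y q != 0} ->
  exists r : {poly int}, exists u v : {poly {poly int}},
    r != 0 /\ r%:P = u * p + v * q.
Proof.
move=> rs0 rsU sp lp rsP; have p0 : p != 0 by rewrite -size_poly_eq0 sp.
pose n := size q; pose q' := q + p * 'X^n.
have sXp : size (p * 'X^n) = (n + size p)%N.
  by rewrite size_mulXn.
have lt_q : (size q < size (p * 'X^n)%R)%N by rewrite sXp sp addnS ltnS leq_addr.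
have lq' : lead_coef q' = lead_coef p.
  by rewrite lead_coefDr // lead_coefM lead_coefXn mulr1.
have sq' : (1 < size q')%N.
  by rewrite /q' addrC size_polyDl // sXp sp addnS ltnS addn_gt0 rs0 orbT.
have sp1 : (1 < size p)%N by rewrite sp ltnS.
have [[u v] _ E] := resultant_in_ideal sp1 sq'.
exists (resultant p q'), (u + v * 'X^n), v; split; last first.
  by rewrite E /q' /=; ring.
(* The leading coefficients survive at [x], so specialization commutes with the resultant; its
   vanishing would give a common factor. *)
apply/eqP => r0; have := congr1 (specialize1 x) r0.
rewrite rmorph0 map_resultant ?lq' // => /eqP; rewrite resultant_eq0.
have rootE f y : root (map_poly (specialize1 x) f) y = (specialize x y f == 0).
  by [].
have smp : size (map_poly (specialize1 x) p) = (size rs).+1.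
  by rewrite size_map_poly_id0.
have pr : all (root (map_poly (specialize1 x) p)) rs.
  by apply/allP => y /rsP[e _]; rewrite rootE e.
rewrite (all_roots_prod_XsubC smp pr) ?uniq_rootsE //.
set c := lead_coef _; have c0 : c != 0 by rewrite lead_coef_eq0 -size_poly_eq0 smp.
suff /coprimep_size_gcd -> : coprimep (c *: \prod_(z <- rs) ('X - z%:P))
  (map_poly (specialize1 x) q') by [].
rewrite coprimepZl // coprimep_sym.
have: {subset rs <= rs} by [].
elim: {1 3}rs => [|y s IH] sub; first by rewrite big_nil coprimep1.
rewrite big_cons coprimepMr IH ?andbT; last first.
  by move=> z zs; apply: sub; rewrite inE zs orbT.
have [py qy] := rsP y (sub y (mem_head y s)).
by rewrite coprimep_XsubC rootE rmorphD rmorphM /= py mul0r addr0.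
Qed.

(** The eliminant involves a alone, so a common zero has its a among finitely many roots; for each
    such a, [C18] has finitely many roots b. *)
Lemma finite_common_zeros (F : fieldType) (q : {poly {poly int}}) :
  [pchar F] =i pred0 ->
  (exists r : {poly int}, exists u v : {poly {poly int}}, r != 0 /\
    r%:P = u * beval (@of_Z {poly {poly int}}) 'X%:P 'X C18_poly + v * q) ->
  exists s : seq (F * F), forall ab,
    C18 ab.1 ab.2 = 0 /\ specialize ab.1 ab.2 q = 0 -> ab \in s.
Proof.
move=> char0 [r [u [v [r0 E]]]].
have intr0 (z : int) : ((z%:~R : F) == 0) = (z == 0).
  have := of_Z_eq0 (Z_of_int z) char0; rewrite /of_Z Z_of_intK => ->.
  exact: (can_eq Z_of_intK z 0).
have rF0 : map_poly (intr : int -> F) r != 0.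
  by rewrite map_poly_eq0_id0 // intr0 lead_coef_eq0.
have [sa saP] := finite_roots rF0.
have sabP (a : F) : exists s : seq (F * F), forall ab : F * F,
    ab.1 = a /\ C18 ab.1 ab.2 = 0 -> ab \in s.
  have [sb sbP] := finite_roots (C18_poly_neq0 a char0).
  exists [seq (a, b) | b <- sb] => -[x y] /= [-> C0].
  by rewrite map_f // sbP // rootE C18_poly_eval C0.
have [s sP] := finite_bigcup (ts := sa) (fun a _ => sabP a).
exists s => ab [C0 q0]; apply: (sP ab.1) => //; apply: saP.
have := specialize_beval ab.1 ab.2 C18_poly; rewrite beval_C18 C0.
move: (beval _ _ _ _) E => c E c0; have := congr1 (specialize ab.1 ab.2) E.
rewrite specializeC rmorphD !rmorphM /= q0 c0 !mulr0 addr0 => r0'.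
by rewrite rootE -[X in X == 0]/(specialize1 ab.1 r) r0'.
Qed.

(** * Finitely many degenerate points on the curve *)

Definition label_pairs : seq (label * label) :=
  [seq kl <- [seq (k, l) | k <- point_labels ++ line_labels,
                           l <- point_labels ++ line_labels]
   | (is_point kl.1 == is_point kl.2) && (kl.1 != kl.2)].

Lemma independentP (F : fieldType) (a b : F) :
  {in label_pairs, forall kl, cross (vec_at (@of_Z F) a b kl.1)
    (vec_at (@of_Z F) a b kl.2) != (0, 0, 0)} -> independent a b.
Proof.
move=> ind k l kL lL e kl; apply: (ind (k, l)).
rewrite mem_filter; apply/andP; split; first by rewrite /= e eqxx.
exact: (allpairs_f (fun k l => (k, l))).
Qed.

(* The first vector is an arbitrary choice for which no mixed product vanishes
   at the five points of the curve with a = 217 over the field with 367 elements;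
   their b-coordinates form curve_fibre. *)
Definition mixed_product (R : comNzRingType) (phi : {rmorphism Z -> R}) (a b : R)
    (kl : label * label) : R :=
  dot (map3 phi (1, 141, 126))
    (cross (vec_at phi a b kl.1) (vec_at phi a b kl.2)).

Lemma rmorph_mixed_product (R S : comNzRingType) (phi : {rmorphism Z -> R})
    (psi : {rmorphism Z -> S}) (h : {rmorphism R -> S}) a b kl :
  h \o phi =1 psi ->
  mixed_product psi (h a) (h b) kl = h (mixed_product phi a b kl).
Proof.
move=> e; rewrite /mixed_product !(vec_map3 _ _ _ e) cross_map3 -dot_map3.
by congr dot; rewrite /map3 -!e.
Qed.

Lemma specialize_mixed_product (R : comNzRingType) (a b : R) kl :
  specialize a b (mixed_product (@of_Z {poly {poly int}}) 'X%:P 'X kl)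
  = mixed_product (@of_Z R) a b kl.
Proof.
rewrite -(@rmorph_mixed_product _ _ (@of_Z {poly {poly int}}) (@of_Z R)); last first.
  by move=> z; rewrite /= /of_Z rmorph_int.
by congr mixed_product; rewrite /= ?specializeC ?specialize1X ?specializeX.
Qed.

Definition curve_fibre : seq Z := [:: 76; 89; 109; 128; 297]%ZZ.

(** The elimination identity is over the integers; reduction modulo 367 certifies that the resultant
    is nonzero. *)
Lemma mixed_product_eliminant (K : fieldType) kl :
  367%N \in [pchar K] -> kl \in label_pairs ->
  exists r : {poly int}, exists u v : {poly {poly int}}, r != 0 /\
    r%:P = u * beval (@of_Z {poly {poly int}}) 'X%:P 'X C18_poly
           + v * mixed_product (@of_Z {poly {poly int}}) 'X%:P 'X kl.
Proof.
move=> pK klP; pose x := of_Z K 217%ZZ.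
have zeroE z : (of_Z K z == 0) = ((z mod 367)%ZZ == 0).
  exact: of_Z_mod_eq0 z pK.
have rU : uniq (map (of_Z K) curve_fibre).
  have fU : uniq curve_fibre by vm_cast_no_check (erefl true).
  rewrite map_inj_in_uniq; first exact: fU.
  move=> y z yC zC /eqP.
  rewrite -subr_eq0 -rmorphB zeroE.
  have : all (fun y => all (fun z => (((y - z) mod 367)%ZZ == 0) ==> (y == z))
    curve_fibre) curve_fibre by vm_cast_no_check (erefl true).
  by move/allP/(_ y yC)/allP/(_ z zC)/implyP => h /h /eqP.
(* The leading coefficient of [C18] in b, which must not vanish at a = 217. *)
pose lc : {poly int} := 'X ^+ 3 + 'X ^+ 2.
have lcE : ueval (@of_Z {poly int}) 'X [:: 0; 0; 1; 1]%ZZ = lc.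
  by rewrite /ueval /= /of_Z /= /Pos.to_nat /= /lc; ring.
pose C := map (ueval (@of_Z {poly int}) 'X) C18_poly.
have lastC : last 0 C = lc by rewrite -lcE.
have lc_x : specialize1 x lc != 0.
  have -> : specialize1 x lc = of_Z K (217%ZZ ^+ 3 + 217%ZZ ^+ 2)%R.
    have lc_h (h : {rmorphism {poly int} -> K}) :
        h lc = h 'X ^+ 3 + h 'X ^+ 2 by rewrite rmorphD !rmorphXn.
    transitivity (x ^+ 3 + x ^+ 2); last by rewrite rmorphD !rmorphXn.
    rewrite [LHS](lc_h (specialize1 x)).
    by rewrite (specialize1X x : GRing.RMorphism.sort (specialize1 x) 'X = x).
  by rewrite zeroE; vm_cast_no_check (erefl true).
have C_last : last 0 C != 0.
  by rewrite lastC; apply: contraNneq lc_x => ->; rewrite rmorph0.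
apply: (@eliminant K x (map (of_Z K) curve_fibre)) rU _ _ _.
- by rewrite size_map.
- by rewrite size_map beval_Poly (PolyK C_last) size_map.
- rewrite beval_Poly lead_coefE (PolyK C_last) nth_last.
  by move: lc_x; rewrite -lastC.
move=> _ /mapP[y yC ->]; rewrite specialize_beval specialize_mixed_product.
pose P w := (beval (idfun : Z -> Z) 217%ZZ w C18_poly mod 367)%ZZ == 0.
pose Q w := all (fun kl =>
  (mixed_product (idfun : Z -> Z) 217%ZZ w kl mod 367)%ZZ != 0) label_pairs.
have : all (fun w => P w && Q w) curve_fibre by vm_cast_no_check (erefl true).
case/allP/(_ y yC)/andP => Cy /allP/(_ kl klP) my; split.
  have := @rmorph_beval Z K idfun (@of_Z K) (@of_Z K) 217%ZZ y C18_poly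
    (fun=> erefl).
  by rewrite -/x => <-; apply/eqP; rewrite zeroE.
have := @rmorph_mixed_product Z K idfun (@of_Z K) (@of_Z K) 217%ZZ y kl
  (fun=> erefl).
by rewrite -/x => ->; rewrite zeroE.
Qed.

(** At a degenerate point some cross product vanishes, and with it the mixed product of that pair of
    labels; each of the finitely many pairs contributes finitely many points. *)
Lemma finite_degenerate (F : fieldType) : [pchar F] =i pred0 ->
  exists s : seq (F * F), forall a b : F,
    C18 a b = 0 -> B18_degenerate a b -> (a, b) \in s.
Proof.
move=> char0; have [|s sP] := @finite_bigcup _ (F * F)%type (fun kl ab =>
  C18 ab.1 ab.2 = 0 /\ mixed_product (@of_Z F) ab.1 ab.2 kl = 0) label_pairs.
  move=> kl klP.
  have p367 := @pchar_Fp 367 isT.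
  have [s sP] := finite_common_zeros char0 (mixed_product_eliminant p367 klP).
  by exists s => ab zeros; apply: sP; rewrite specialize_mixed_product.
exists s => a b C0; apply: contraTT => abN.
have ind : independent a b; last by have [] := nondegenerate_of_independent ind.
apply: independentP => kl klP; apply: contraNneq abN => cr0.
apply: (sP kl klP (a, b)); split; first exact: C0.
by rewrite /mixed_product cr0 /dot /= !mulr0 !addr0.
Qed.

(** * Infinitely many real realizations *)

Section RealPoints.

Import Order.TTheory Num.Theory.

(** Intermediate values for b between -a and 0; both end values are rewritten so that their signs
    are visible for such a. *)
Lemma curve_real_point (R : rcfType) (a : R) : 4 <= a -> exists b, C18 a b = 0.
Proof.
move=> a4; have a0 : 0 <= a by apply: le_trans a4.
have neg : C18 a (- a) <= 0.
  rewrite (_ : C18 a (- a) = - (a ^+ 8 + 9 * a ^+ 7 + 14 * a ^+ 6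
    + a ^+ 4 * (46 * a - 15) + 9 * a ^+ 3)); last by rewrite /C18; ring.
  have h : 0 <= 46 * a - 15 by lra.
  by rewrite oppr_le0 !addr_ge0 ?mulr_ge0 ?exprn_ge0 ?ler0n.
have pos : 0 <= C18 a 0.
  rewrite (_ : C18 a 0 = a ^+ 3 * ((a - 4) * (a * (a - 1) + 2) + 4)); last first.
    by rewrite /C18; ring.
  have [h1 h2] : 0 <= a - 4 /\ 0 <= a - 1 by split; lra.
  have h3 := mulr_ge0 a0 h2; apply: mulr_ge0; first exact: exprn_ge0.
  by apply: addr_ge0 => //; apply: mulr_ge0 => //; apply: addr_ge0.
have := @poly_ivt R (beval (@of_Z {poly R}) a%:P 'X C18_poly) (- a) 0.
rewrite !C18_poly_eval neg pos oppr_le0 => /(_ a0 isT)[b _].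
by rewrite rootE C18_poly_eval => /eqP; exists b.
Qed.

Lemma real_realizations (R : rcfType) (s : seq (R * R)) :
  exists a b : R, [/\ (a, b) \notin s, C18 a b = 0 & ~~ B18_degenerate a b].
Proof.
have [t tP] := finite_degenerate (@pchar_num R).
(* This exceeds the first coordinate of every pair in [s] and of every degenerate pair in [t], and
   is at least 4. *)
pose a := 4 + \sum_(x <- s ++ t) `|x.1|.
have a4 : 4 <= a by rewrite lerDl sumr_ge0.
have [b C0] := curve_real_point a4; exists a, b.
have abN : (a, b) \notin s ++ t.
  apply/negP => abS.
  have : `|a| <= \sum_(x <- s ++ t) `|x.1|.
    by rewrite (big_rem _ abS) /= lerDl sumr_ge0.
  rewrite ger0_norm; last by apply: le_trans a4.
  by rewrite /a gerDr; lra.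
move: abN; rewrite mem_cat negb_or => /andP[abs abt]; split=> //.
by apply: contraNN abt; apply: tP.
Qed.

End RealPoints.

Theorem mainTheorem7 :
  (forall F : fieldType, [pchar F] =i pred0 ->
    (* some points are not necessarily triple *)
    (exists a b : F,
      [/\ a != 1, b != 1, a != b, ~~ B18_degenerate a b &
          forall Q, Q \in B18_doubtful_points a b ->
            ~~ triple_point (B18_lines a b) Q]) /\
    (* the conditions to have them triple, and the equation of the curve *)
    (forall a b : F, a != 1 -> b != 1 -> a != b -> ~~ B18_degenerate a b ->
      [/\ forall Q, Q \in B18_automatic_points a b ->
            triple_point (B18_lines a b) Q,
          (forall Q, Q \in B18_points a b -> triple_point (B18_lines a b) Q)
            <-> B18_conditions a b &
          B18_conditions a b <-> C18 a b = 0]) /\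
    (* the curve does not lead to a degenerate case, individual points apart *)
    (exists s : seq (F * F),
      forall a b : F, C18 a b = 0 -> B18_degenerate a b -> (a, b) \in s)) /\
  (* nondegenerate realizations exist; there are infinitely many real ones *)
  (forall (R : rcfType) (s : seq (R * R)),
    exists a b : R,
      [/\ (a, b) \notin s, C18 a b = 0 & ~~ B18_degenerate a b]).
Proof.
split; last exact: real_realizations.
move=> F char0; split; first exact: generic_nondegenerate.
split; last exact: finite_degenerate.
by move=> a b _ _ _; apply: triple_iff_curve.
Qed.
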